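(* Let $\xi$ be a random vector in $\mathbb{R}^d$ and let $T\subset\mathbb{R}^d$ be a convex set containing the origin. Assume that for every $\sigma>0$ the maximizer $$r(\sigma)=\operatorname*{arg\,max}_{r\ge 0}\Big\{w_\xi(T\cap rB_2^d)-\frac{r^2}{2\sigma}\Big\}$$ exists and is unique. Then, for each $\sigma>0$, $$w_\xi(T)=\Big\{w_\xi\big(T\cap r(\sigma)B_2^d\big)-\frac{r(\sigma)^2}{2\sigma}\Big\}+\frac12\int_\sigma^\infty\frac{r(\nu)^2}{\nu^2}\,d\nu .$$ In particular, $$w_\xi(T)=\frac12\int_0^\infty\frac{r(\nu)^2}{\nu^2}\,d\nu .$$
   Context: For a random vector $\xi\in\mathbb{R}^d$ and a nonempty set $S\subset\mathbb{R}^d$, the $\xi$-width is $w_\xi(S)=\mathbb{E}\big[\sup_{x\in S}\langle\xi,x\rangle\big]$; when $0\in S$ this is an element of $[0,+\infty]$. $B_2^d$ is the closed Euclidean unit ball of $\mathbb{R}^d$. The identities are understood in $[0,+\infty]$. *)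

(* Defs.v *)
From HB Require Import structures.
From mathcomp Require Import all_boot all_order all_algebra.
From mathcomp Require Import all_classical all_reals all_analysis.
Set Implicit Arguments.
Unset Strict Implicit.
Unset Printing Implicit Defensive.
Import Order.TTheory GRing.Theory Num.Theory.
Import numFieldNormedType.Exports.
Local Open Scope classical_set_scope.
Local Open Scope ring_scope.

Definition dotv (R : realType) (d : nat) (x y : 'rV[R]_d) : R :=
  \sum_(i < d) x 0 i * y 0 i.

(* The library norm on ['rV[R]_d] is the sup norm, hence the explicit
   Euclidean norm. *)
Definition norm2 (R : realType) (d : nat) (x : 'rV[R]_d) : R :=
  Num.sqrt (dotv x x).

Definition ball2 (R : realType) (d : nat) : set 'rV[R]_d :=
  [set x | norm2 x <= 1].

Arguments ball2 : clear implicits.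

Definition scaleset (R : realType) (d : nat) (r : R) (A : set 'rV[R]_d) :
    set 'rV[R]_d :=
  [set r *: x | x in A].

(* For [0 \in S] the integrand is nonnegative, so the integral is the usual
   one with values in [0, +oo]; it is measurable for every [S], since
   the supremum is a lower semicontinuous function of [xi w]. *)
Definition width (disp : measure_display) (Omega : measurableType disp)
    (R : realType) (d : nat) (P : probability Omega R)
    (xi : Omega -> 'rV[R]_d) (S : set 'rV[R]_d) : \bar R :=
  (\int[P]_w ereal_sup [set (dotv (xi w) x)%:E | x in S])%E.

Definition argmax (R : realType) (A : set R) (f : R -> \bar R) : set R :=
  [set x | A x /\ forall y, A y -> (f y <= f x)%E].

(* Main.v *)
(* Put [g s := width (T `&` s B)] and [F sigma := max_s (g s - s^2 / (2 sigma))],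
   attained at [r sigma]. Testing the maximum at [x] with [r y] and conversely gives
     [r x ^2 / 2 * (1/x - 1/y) <= F y - F x <= r y ^2 / 2 * (1/x - 1/y)]
   for [0 < x <= y]. Hence [r] is nondecreasing, and since [1/x - 1/y] is the
   integral of [nu^-2] over [[x, y]], the increment [F y - F x] and the integral
   of [r nu ^2 / (2 nu^2)] obey the same bounds on every subinterval, so they are
   equal. Finally [F sigma] increases to [width T] as [sigma] goes to infinity,
   by monotone convergence, and tends to [0] as [sigma] goes to [0], by dominated
   convergence, because [r sigma] then tends to [0]. *)
Require Import Defs.
From mathcomp Require Import all_boot all_order all_algebra.
From mathcomp Require Import all_classical all_reals all_analysis.
From mathcomp Require Import measurable_realfun ring lra.
Set Implicit Arguments.
Unset Strict Implicit.
Unset Printing Implicit Defensive.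
Import Order.TTheory GRing.Theory Num.Theory.
Import numFieldNormedType.Exports.
Local Open Scope classical_set_scope.
Local Open Scope ring_scope.

(** * Integration against the weight [x ^- 2], from bounded intervals to half-lines *)

Lemma measurable_fun_invr_sqr (R : realType) :
  measurable_fun (`]0, +oo[ : set R) (fun x : R => x ^- 2).
Proof.
apply: open_continuous_measurable_fun; first exact: interval_open.
move=> x; rewrite inE/= in_itv/= andbT => x0.
by apply: cvgV; [rewrite expf_neq0// gt_eqF | exact: exprn_continuous].
Qed.

(** Fundamental theorem of calculus with primitive [- x^-1]. The interval is half-open so that
    consecutive intervals are disjoint and concatenate. *)
Lemma integral_invr_sqr (R : realType) (a b : R) : 0 < a -> a <= b ->
  (\int[lebesgue_measure]_(x in `]a, b]) (x ^- 2)%:E = (a^-1 - b^-1)%:E)%E.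
Proof.
move=> a0; rewrite le_eqVlt => /predU1P[<-|ab].
  by rewrite set_itvoc0 integral_set0 subrr.
have inv_neq0 x : a <= x -> x != 0 by move=> ax; rewrite gt_eqF// (lt_le_trans a0).
have dinv x : a <= x -> is_derive x 1 (fun y : R => - y^-1) (x ^- 2).
  move=> /inv_neq0 x0.
  have h := @is_deriveV R id x 1 1 x0 (is_derive_id _ _).
  have := is_deriveN h.
  by rewrite -scaleNr opprK [_ *: _]mulr1.
have cinv x : a <= x -> {for x, continuous (fun y : R => - y^-1)}.
  by move=> /inv_neq0 x0; apply: cvgN; apply: inv_continuous.
have cab : {within `[a, b], continuous (fun y : R => y ^- 2)}.
  apply: continuous_in_subspaceT => x /[!inE]/= /[!in_itv]/= /andP[ax _].
  apply: cvgV; first by rewrite expf_neq0// inv_neq0.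
  exact: exprn_continuous.
rewrite integral_itv_obnd_cbnd; last first.
  apply/measurable_EFinP; apply: measurable_funS (@measurable_fun_invr_sqr R) => //.
  by move=> x /=; rewrite !in_itv/= => /andP[ax _]; rewrite (lt_trans a0).
rewrite (@continuous_FTC2 _ (fun y : R => y ^- 2) (fun y : R => - y^-1))//.
- by rewrite -EFinB opprK addrC.
- split=> [x /[!in_itv]/= /andP[ax _]||].
  + by case: (dinv _ (ltW ax)).
  + by apply: cvg_at_right_filter; exact: cinv.
  + by apply: cvg_at_left_filter; exact: cinv (ltW ab).
- move=> x /[!in_itv]/= /andP[ax _]; rewrite derive1E.
  by case: (dinv _ (ltW ax)).
Qed.

(* Splitting at the harmonic mean of [x] and [y] halves [x^-1 - y^-1] on both
   sides while the increments of [q] add up, so the bound can be halved forever. *)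
Lemma eq_of_increment_bound (R : realType) (E q : R -> R) (a b : R) :
  0 < a -> a <= b ->
  (forall x y, a <= x -> x <= y ->
     `|E y - E x| <= (q y - q x) * (x^-1 - y^-1)) ->
  E b = E a.
Proof.
move=> a0 ab HE.
have H n x y : a <= x -> x <= y ->
    2 ^+ n * `|E y - E x| <= (q y - q x) * (x^-1 - y^-1).
  elim: n x y => [|n IH] x y ax xy; first by rewrite expr0 mul1r HE.
  have x0 : 0 < x := lt_le_trans a0 ax.
  have y0 : 0 < y := lt_le_trans x0 xy.
  pose z := 2 / (x^-1 + y^-1).
  have s0 : 0 < x^-1 + y^-1 by rewrite addr_gt0 ?invr_gt0.
  have zV : z^-1 = (x^-1 + y^-1) / 2 by rewrite /z invf_div.
  have z0 : 0 < z by rewrite divr_gt0.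
  have yx : y^-1 <= x^-1 by rewrite lef_pV2.
  have xz : x <= z by rewrite -(lef_pV2 z0 x0) zV; lra.
  have zy : z <= y by rewrite -(lef_pV2 y0 z0) zV; lra.
  have := IH _ _ ax xz; have := IH _ _ (le_trans ax xz) zy; rewrite zV => h1 h2.
  have h3 : `|E y - E x| <= `|E y - E z| + `|E z - E x|.
    by rewrite -(subrKA (E z)) ler_normD.
  rewrite exprS -mulrA.
  have : 2 ^+ n * `|E y - E x| <= 2 ^+ n * (`|E y - E z| + `|E z - E x|).
    by rewrite ler_wpM2l// exprn_ge0.
  rewrite mulrDr; lra.
apply/eqP; rewrite -subr_eq0 -normr_le0 leNgt; apply/negP => e0.
(* By [H], the number [c] bounds every power [2 ^+ n], while [upper_nthrootP] provides a power
   exceeding it. *)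
pose c := (q b - q a) * (a^-1 - b^-1) / `|E b - E a|.
have := @upper_nthrootP _ c _ (leqnn _).
rewrite ltNge => /negP; apply.
by rewrite ler_pdivlMr// H.
Qed.

Lemma measurable_fun_div_sqr (R : realType) (q : R -> R) :
  (forall x, 0 < x -> 0 <= q x) ->
  (forall x y, 0 < x -> x <= y -> q x <= q y) ->
  measurable_fun (`]0, +oo[ : set R) (fun x => (q x / x ^+ 2)%:E).
Proof.
move=> q0 qnd; apply/measurable_EFinP.
apply: measurable_funM; last exact: measurable_fun_invr_sqr.
(* Monotonicity of [q] is known on the positive axis only; since [q] is nonnegative there, its
   extension by 0 is monotone on the whole line. *)
apply: (@eq_measurable_fun _ _ _ _ _ (fun x : R => if 0 < x then q x else 0)).
  by move=> x; rewrite inE/= in_itv/= andbT => ->.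
apply: nondecreasing_measurable => // x y xy.
case: ifPn => [x0|_]; first by rewrite (lt_le_trans x0 xy) qnd.
by case: ifPn => // /q0.
Qed.

(** On each subinterval the increment of [F] and the integral lie between the same two bounds,
    because [q] lies between its endpoint values. Hence [F - J] satisfies the hypothesis of
    [eq_of_increment_bound] and is constant. *)
Lemma integral_envelope (R : realType) (F q : R -> R) (a b : R) :
  (forall x, 0 < x -> 0 <= q x) ->
  (forall x y, 0 < x -> x <= y -> q x <= q y) ->
  (forall x y, 0 < x -> x <= y ->
    q x * (x^-1 - y^-1) <= F y - F x <= q y * (x^-1 - y^-1)) ->
  0 < a -> a <= b ->
  (\int[lebesgue_measure]_(x in `]a, b]) (q x / x ^+ 2)%:E = (F b - F a)%:E)%E.
Proof.
move=> q0 qnd HF a0 ab.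
have mq := measurable_fun_div_sqr q0 qnd.
pose J y := (\int[lebesgue_measure]_(x in `]a, y]) (q x / x ^+ 2)%:E)%E.
have itv_sub x y : 0 < x -> `]x, y] `<=` (`]0, +oo[ : set R).
  by move=> x0 z /=; rewrite !in_itv/= andbT => /andP[+ _]; exact: lt_trans.
have I_ge0 x y : 0 < x ->
    (0 <= \int[lebesgue_measure]_(x in `]x, y]) (q x / x ^+ 2)%:E)%E.
  move=> x0; apply: integral_ge0 => z /(itv_sub _ _ x0)/=.
  rewrite in_itv/= andbT => z0.
  by rewrite lee_fin divr_ge0 ?q0// exprn_ge0 ?ltW.
have I_bound x y : 0 < x -> x <= y ->
    ((q x * (x^-1 - y^-1))%:E <=
       \int[lebesgue_measure]_(x in `]x, y]) (q x / x ^+ 2)%:E <=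
     (q y * (x^-1 - y^-1))%:E)%E.
  move=> x0 xy; have y0 := lt_le_trans x0 xy.
  have mV : measurable_fun `]x, y] (fun z : R => (z ^- 2)%:E).
    apply/measurable_EFinP.
    exact: measurable_funS (itv_sub _ _ x0) (@measurable_fun_invr_sqr R).
  have V0 z : `]x, y]%classic z -> 0 <= z ^- 2.
    by move=> _; rewrite invr_ge0 sqr_ge0.
  have mI := measurable_funS (@measurable_itv _ _) (itv_sub x y x0) mq.
  rewrite !EFinM -integral_invr_sqr// -!ge0_integralZl ?lee_fin ?q0//.
  apply/andP; split; apply: ge0_le_integral => //=.
  - by move=> z zxy; rewrite mule_ge0// lee_fin ?V0 ?q0.
  - exact: measurable_funeM.
  - move=> z zxy; rewrite -EFinM lee_fin ler_wpM2r ?V0//.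
    by move: zxy; rewrite in_itv/= => /andP[xz _]; rewrite qnd// ltW.
  - move=> z zxy; rewrite lee_fin mulr_ge0 ?V0// q0//.
    by move: zxy; rewrite in_itv/= => /andP[xz _]; exact: lt_trans xz.
  - exact: measurable_funeM.
  - move=> z zxy; rewrite -EFinM lee_fin ler_wpM2r ?V0//.
    move: zxy; rewrite in_itv/= => /andP[xz zy].
    by rewrite qnd// (lt_trans x0).
have I_fin x y : 0 < x -> x <= y ->
    (\int[lebesgue_measure]_(x in `]x, y]) (q x / x ^+ 2)%:E)%E \is a fin_num.
  move=> x0 xy; rewrite ge0_fin_numE ?I_ge0//.
  by have /andP[_ /le_lt_trans->] := I_bound _ _ x0 xy; rewrite ?ltry.
have I_add x y z : 0 < x -> x <= y -> y <= z ->
    (\int[lebesgue_measure]_(x in `]x, z]) (q x / x ^+ 2)%:E =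
     \int[lebesgue_measure]_(x in `]x, y]) (q x / x ^+ 2)%:E +
     \int[lebesgue_measure]_(x in `]y, z]) (q x / x ^+ 2)%:E)%E.
  move=> x0 xy yz; have y0 := lt_le_trans x0 xy.
  rewrite (@itv_bndbnd_setU _ _ _ (BRight y)) ?bnd_simp//.
  rewrite ge0_integral_setU//.
  - apply: measurable_funS mq => //.
    by rewrite subUset; split; exact: itv_sub.
  - move=> t tI; rewrite lee_fin divr_ge0 ?sqr_ge0// q0//.
    by case: tI => /itv_sub => /(_ _)/=; rewrite in_itv/= andbT; exact.
  - apply/disj_setPS => t /=; rewrite !in_itv/= => -[/andP[_ ty] /andP[+ _]].
    by rewrite ltNge ty.
have E_bound x y : a <= x -> x <= y ->
    `|(F y - fine (J y)) - (F x - fine (J x))| <= (q y - q x) * (x^-1 - y^-1).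
  move=> ax xy; have x0 := lt_le_trans a0 ax.
  have JE : fine (J y) = fine (J x) +
     fine (\int[lebesgue_measure]_(x in `]x, y]) (q x / x ^+ 2)%:E)%E.
    by rewrite /J (I_add a x y)// fineD ?I_fin.
  have := I_bound _ _ x0 xy; have := HF _ _ x0 xy.
  rewrite JE -[X in (_ <= X <= _)%E]fineK ?I_fin// !lee_fin.
  move=> /andP[h1 h2] /andP[h3 h4].
  by rewrite ler_norml; apply/andP; split; lra.
have := @eq_of_increment_bound _ (fun x => F x - fine (J x)) q a b a0 ab E_bound.
(* The constant is [F a], as [J a] integrates over an empty interval. *)
rewrite {2}/J set_itvoc0 integral_set0/= => E0.
rewrite -[LHS]fineK ?I_fin//; congr EFin; rewrite -/(J b); lra.
Qed.

(** Monotone convergence along the intervals from [a] to [a + n]. The limit [l] is an extended real,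
    so a divergent integral is covered. *)
Lemma integral_envelope_tail (R : realType) (F q : R -> R) (a : R) (l : \bar R) :
  (forall x, 0 < x -> 0 <= q x) ->
  (forall x y, 0 < x -> x <= y -> q x <= q y) ->
  (forall x y, 0 < x -> x <= y ->
    q x * (x^-1 - y^-1) <= F y - F x <= q y * (x^-1 - y^-1)) ->
  0 < a -> (F (a + n%:R))%:E @[n --> \oo] --> l ->
  (l = (F a)%:E + \int[lebesgue_measure]_(x in `]a, +oo[) (q x / x ^+ 2)%:E)%E.
Proof.
move=> q0 qnd HF a0 Fl.
have mq := measurable_fun_div_sqr q0 qnd.
have sub n : `]a, a + n%:R] `<=` (`]0, +oo[ : set R).
  by move=> z /=; rewrite !in_itv/= andbT => /andP[+ _]; exact: lt_trans.
have -> : `]a, +oo[%classic = \bigcup_n `]a, a + n%:R]%classic.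
  apply/seteqP; split=> [x /=|x [n _] /=]; rewrite !in_itv/= ?andbT; last by case/andP.
  move=> ax; exists (Num.bound (x - a)) => //=.
  by rewrite in_itv/= ax/= -lerBlDl ltW// archi_boundP// subr_ge0 ltW.
apply: (@cvg_unique _ (@ereal_hausdorff R) _ _ _ _ Fl).
rewrite (_ : (fun n => _) = (fun n => (F a)%:E +
    \int[lebesgue_measure]_(x in `]a, (a + n%:R)%R]) (q x / x ^+ 2)%:E)%E); last first.
  apply/funext => n; rewrite (integral_envelope q0 qnd HF)// ?lerDl//.
  by rewrite -EFinD subrKC.
apply: cvgeD; [by []|exact: cvg_cst|].
apply: ge0_nondecreasing_set_cvg_integral => [m n mn|n|n|n x].
- apply/subsetPset => x /=; rewrite !in_itv/= => /andP[-> /le_trans->]//.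
  by rewrite lerD2l ler_nat.
- exact: measurable_itv.
- exact: measurable_funS mq.
- move=> /sub/=; rewrite in_itv/= andbT => x0.
  by rewrite lee_fin divr_ge0 ?sqr_ge0 ?q0.
Qed.

(** The constant sequence [l] is rewritten by the tail identity at [x = 1 / (n + 1)]; the term in
    [F] vanishes in the limit and the integrals increase to the full one. *)
Lemma integral_envelope_setT (R : realType) (F q : R -> R) (l : \bar R) :
  (forall x, 0 < x -> 0 <= q x) ->
  (forall x y, 0 < x -> x <= y -> q x <= q y) ->
  (forall x : R, 0 < x ->
    (l = (F x)%:E +
      \int[lebesgue_measure]_(x in `]x, +oo[) (q x / x ^+ 2)%:E)%E) ->
  (F n.+1%:R^-1)%:E @[n --> \oo] --> 0%E ->
  (l = \int[lebesgue_measure]_(x in `]0%R, +oo[) (q x / x ^+ 2)%:E)%E.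
Proof.
move=> q0 qnd lE F0.
have mq := measurable_fun_div_sqr q0 qnd.
have sub n : `]n.+1%:R^-1, +oo[ `<=` (`]0, +oo[ : set R).
  by move=> z /=; rewrite !in_itv/= !andbT; apply: lt_trans.
have -> : (`]0, +oo[%classic : set R) = \bigcup_n `]n.+1%:R^-1, +oo[%classic.
  apply/seteqP; split=> [x /=|x [n _]]; last exact: sub.
  rewrite in_itv/= andbT => x0; exists (Num.bound x^-1) => //=.
  rewrite in_itv/= andbT invf_plt ?posrE//.
  by rewrite (lt_le_trans (archi_boundP _)) ?ler_nat// ltW// invr_gt0.
rewrite -[RHS]add0e.
apply: (@cvg_unique _ (@ereal_hausdorff R) _ _ _ _ (@cvg_cst _ l _ \oo _)).
rewrite (_ : (fun=> l) = (fun n => (F (n.+1%:R^-1)%R)%:E +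
    \int[lebesgue_measure]_(x in `](n.+1%:R^-1)%R, +oo[) (q x / x ^+ 2)%:E)%E); last first.
  by apply/funext => n; rewrite -lE ?invr_gt0.
apply: cvgeD; [by []|exact: F0|].
apply: ge0_nondecreasing_set_cvg_integral => [m n mn|n|n|n x].
- apply/subsetPset => x /=; rewrite !in_itv/= !andbT; apply: le_lt_trans.
  by rewrite lef_pV2 ?posrE// ler_nat.
- exact: measurable_itv.
- exact: measurable_funS mq.
- move=> /sub/=; rewrite in_itv/= andbT => x0.
  by rewrite lee_fin divr_ge0 ?sqr_ge0 ?q0.
Qed.

(** * Support functions, and the behavior of the width under limits of sets *)

Definition support_fun (R : realType) (d : nat) (S : set 'rV[R]_d)
    (u : 'rV[R]_d) : \bar R :=
  ereal_sup [set (dotv u x)%:E | x in S].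

Lemma support_fun_le (R : realType) (d : nat) (A B : set 'rV[R]_d) u :
  A `<=` B -> (support_fun A u <= support_fun B u)%E.
Proof. by move=> AB; apply/ereal_sup_le/image_subset. Qed.

Lemma support_fun_ge0 (R : realType) (d : nat) (S : set 'rV[R]_d) u :
  S 0 -> (0 <= support_fun S u)%E.
Proof.
move=> S0; apply: ereal_sup_ubound; exists 0 => //.
by rewrite /dotv big1// => i _; rewrite mxE mulr0.
Qed.

(** Lower semicontinuity of a supremum of continuous functions: the superlevel set is a union of
    open sets, one for each point of [S]. This gives measurability for arbitrary, possibly
    uncountable [S]. *)
Lemma open_support_fun_gt (R : realType) (d : nat) (S : set 'rV[R]_d) (a : \bar R) :
  open [set u | (a < support_fun S u)%E].
Proof.
rewrite (_ : [set u | _] = \bigcup_(x in S) [set u | (a < (dotv u x)%:E)%E]).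
  apply: bigcup_open => x _.
  have dotc : continuous (fun u : 'rV[R]_d => dotv u x).
    apply: continuous_big => [|i _ u]; first exact: add_continuous.
    exact: (@cvgMr_tmp R _ _ _ (fun v : 'rV[R]_d => v 0 i) _ _
      (@coord_continuous R 1 d 0 i u)).
  case: a => [a| |] /=.
  - exact: (open_comp (fun u _ => dotc u) (@open_gt R a)).
  - rewrite (_ : (fun u => _) = set0); first exact: open0.
    by apply/seteqP; split=> u.
  - rewrite (_ : (fun u => _) = setT); first exact: openT.
    by apply/seteqP; split=> u //= _; rewrite ltNyr.
apply/seteqP; split=> u /=.
- by move=> /ereal_sup_gt[_ [x Sx <-] ax]; exists x.
- by move=> [x Sx /= /lt_le_trans]; apply; apply: ereal_sup_ubound; exists x.
Qed.

Section width.
Context (R : realType) (d : nat) (disp : measure_display)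
  (Omega : measurableType disp) (P : probability Omega R)
  (xi : {RV P >-> g_sigma_algebraType (@open 'rV[R]_d)}).
Implicit Types A B S : set 'rV[R]_d.

Lemma measurable_support_fun S :
  measurable_fun setT (fun w => support_fun S (xi w)).
Proof.
apply: (measurability _ (measurable_realfun.ErealGenOInfty.measurableE R)).
move=> _ [_ [a ->] <-]; rewrite setTI.
rewrite (_ : _ @^-1` _ = xi @^-1` [set u | (a%:E < support_fun S u)%E]); last first.
  by apply/seteqP; split=> w /=; rewrite in_itv/= andbT.
apply: measurable_funPTI; apply: sub_sigma_algebra.
exact: open_support_fun_gt.
Qed.

Lemma width_ge0 S : S 0 -> (0 <= width P xi S)%E.
Proof. by move=> S0; apply: integral_ge0 => w _; exact: support_fun_ge0. Qed.

Lemma width_le A B : A 0 -> A `<=` B -> (width P xi A <= width P xi B)%E.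
Proof.
move=> A0 AB; apply: ge0_le_integral => //.
- by move=> w _; exact: support_fun_ge0.
- exact: measurable_support_fun.
- exact: measurable_support_fun.
- by move=> w _; exact: support_fun_le.
Qed.

(** The support function of an increasing union is the increasing limit of the support functions, so
    monotone convergence applies. *)
Lemma width_bigcup_le (S : (set 'rV[R]_d)^nat) (M : \bar R) :
  (forall n, S n 0) -> (forall m n, (m <= n)%N -> S m `<=` S n) ->
  (forall n, width P xi (S n) <= M)%E -> (width P xi (\bigcup_n S n) <= M)%E.
Proof.
move=> S0 Snd SM.
have supE u : support_fun (\bigcup_n S n) u = 
      ereal_sup (range (fun n => support_fun (S n) u)).
  apply/eqP; rewrite eq_le; apply/andP; split.
    apply: ge_ereal_sup => _ [x [n _ Snx] <-].
    apply: le_ereal_sup_tmp; exists (support_fun (S n) u); first by exists n.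
    by apply: ereal_sup_ubound; exists x.
  apply: ge_ereal_sup => _ [n _ <-]; apply: support_fun_le.
  exact: bigcup_sup.
have nd w : nondecreasing_seq (fun n => support_fun (S n) (xi w)).
  by move=> m n mn; apply: support_fun_le; exact: Snd.
rewrite /width -/(support_fun _ _).
under eq_integral => w _.
  rewrite -/(support_fun (\bigcup_n S n) (xi w)) supE.
  rewrite -(cvg_lim _ (ereal_nondecreasing_cvgn (nd w)))//.
  over.
rewrite monotone_convergence//.
- apply: lime_le; last exact: nearW.
  by apply: ereal_nondecreasing_is_cvgn => m n mn; apply: width_le => //; exact: Snd.
- by move=> n; exact: measurable_support_fun.
- by move=> n w _; exact: support_fun_ge0.
Qed.

(* Dominated convergence: the support function of [S n] at [u] is at most
   [s n * \sum_i `|u_i|]. *)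
Lemma width_cvg0 (S : (set 'rV[R]_d)^nat) (A : set 'rV[R]_d) (s : R^nat) :
  (forall n, S n 0) -> (forall n, S n `<=` A) -> (width P xi A < +oo)%E ->
  (forall n x i, S n x -> `|x 0 i| <= s n) -> s @ \oo --> 0 ->
  width P xi (S n) @[n --> \oo] --> 0%E.
Proof.
move=> S0 SA Afin Ss s0.
have A0 : A 0 by apply: (SA 0%N).
have supp0 w : support_fun (S n) (xi w) @[n --> \oo] --> 0%E.
  apply: (@squeeze_cvge _ _ _ _ (cst 0%E) _
    (fun n => (s n * \sum_i `|xi w 0 i|)%:E)) => //.
  - apply: nearW => n; rewrite support_fun_ge0//=.
    apply: ge_ereal_sup => _ [x Snx <-]; rewrite lee_fin /dotv mulr_sumr.
    apply: ler_sum => i _; rewrite (le_trans (ler_norm _))// normrM mulrC.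
    by rewrite ler_wpM2r// Ss.
  - exact: cvg_cst.
  - apply: cvg_EFin; first exact: nearW.
    by rewrite -[X in _ --> X](mul0r (\sum_i `|xi w 0 i|)); exact: cvgMr_tmp.
have iA : P.-integrable setT (fun w => support_fun A (xi w)).
  apply/integrableP; split; first exact: measurable_support_fun.
  under eq_integral => w _ do rewrite gee0_abs ?support_fun_ge0//.
  exact: Afin.
have SAw n w : (`|support_fun (S n) (xi w)| <= support_fun A (xi w))%E.
  by rewrite gee0_abs ?support_fun_ge0//; exact: support_fun_le.
have [_ _] := dominated_convergence measurableT
  (fun n => measurable_support_fun (S n)) (measurable_cst 0%E)
  (aeW P (fun w _ => supp0 w)) iA (aeW P (fun w n _ => SAw n w)).
by rewrite integral0.
Qed.

End width.

(** * Euclidean norm and scaled balls *)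

Lemma norm2Z (R : realType) (d : nat) (c : R) (x : 'rV[R]_d) :
  norm2 (c *: x) = `|c| * norm2 x.
Proof.
rewrite /norm2 (_ : dotv _ _ = c ^+ 2 * dotv x x).
  by rewrite sqrtrM ?sqr_ge0// sqrtr_sqr.
by rewrite /dotv mulr_sumr; apply: eq_bigr => i _; rewrite !mxE; ring.
Qed.

Lemma coord_le_norm2 (R : realType) (d : nat) (x : 'rV[R]_d) i :
  `|x 0 i| <= norm2 x.
Proof.
rewrite -sqrtr_sqr ler_wsqrtr// /dotv (bigD1 i)//= -expr2 lerDl.
by apply: sumr_ge0 => j _; rewrite -expr2 sqr_ge0.
Qed.

Lemma scaleset_ball2E (R : realType) (d : nat) (s : R) : 0 <= s ->
  scaleset s (ball2 R d) = [set x | norm2 x <= s].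
Proof.
move=> s0; apply/seteqP; split=> x /=.
  by move=> [y /= y1 <-]; rewrite norm2Z ger0_norm// ler_piMr.
(* Rescaling by [s^-1] fails at [s = 0]; there [norm2 x <= 0] forces every coordinate of [x] to
   vanish. *)
move=> xs; case: (eqVneq s 0) => [s_eq0|s_neq0].
  exists 0; first by rewrite /ball2/= -(scale0r 0) norm2Z normr0 mul0r.
  rewrite scaler0; apply/rowP => i; rewrite mxE; apply/esym/eqP.
  by rewrite -normr_le0 (le_trans (coord_le_norm2 x i))// -s_eq0.
exists (s^-1 *: x); last by rewrite scalerA divff// scale1r.
have s_gt0 : 0 < s by rewrite lt_neqAle eq_sym s_neq0.
by rewrite /ball2/= norm2Z ger0_norm ?invr_ge0// mulrC ler_pdivrMr// mul1r.
Qed.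

Theorem theorem2p1 (R : realType) (d : nat) (disp : measure_display)
    (Omega : measurableType disp) (P : probability Omega R)
    (xi : {RV P >-> g_sigma_algebraType (@open 'rV[R]_d)}) (T : set 'rV[R]_d) (r : R -> R)
    (T_convex : convex_set T) (T0 : T 0)
    (r_argmax : forall sigma : R, 0 < sigma ->
      argmax [set s | 0 <= s] (fun s =>
        width P xi (T `&` scaleset s (ball2 R d)) -
          (s ^+ 2 / (2 * sigma))%:E)%E
      = [set r sigma]) :
  (forall sigma : R, 0 < sigma ->
    (width P xi T =
      (width P xi (T `&` scaleset (r sigma) (ball2 R d)) -
         (r sigma ^+ 2 / (2 * sigma))%:E) +
      (2^-1)%:E * \int[lebesgue_measure]_(nu in `]sigma, +oo[)
                     (r nu ^+ 2 / nu ^+ 2)%:E)%E) /\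
  (width P xi T =
     (2^-1)%:E * \int[lebesgue_measure]_(nu in `]0%R, +oo[)
                    (r nu ^+ 2 / nu ^+ 2)%:E)%E.

Proof.

(* Truncations of [T], maximizers and finiteness of the truncated widths *)
pose B s := T `&` scaleset s (ball2 R d).
have B0 s : 0 <= s -> B s 0.
  by move=> s0; split=> //; rewrite scaleset_ball2E//= -(scale0r 0) norm2Z normr0 mul0r.
have Bnd s t : 0 <= s -> s <= t -> B s `<=` B t.
  move=> s0 st x [Tx]; rewrite scaleset_ball2E// => xs; split=> //.
  by rewrite scaleset_ball2E ?(le_trans s0)//=; exact: le_trans st.
have Bw s : 0 <= s -> (width P xi (B s) <= width P xi T)%E.
  by move=> s0; apply: width_le; [exact: B0|exact: subIsetl].
have rP sigma : 0 < sigma -> 0 <= r sigma /\ forall s, 0 <= s ->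
    (width P xi (B s) - (s ^+ 2 / (2 * sigma))%:E <=
     width P xi (B (r sigma)) - (r sigma ^+ 2 / (2 * sigma))%:E)%E.
  by move=> sigma0; have : [set r sigma] (r sigma) by []; rewrite -r_argmax.
have r0 sigma : 0 < sigma -> 0 <= r sigma by case/rP.
(* If [width P xi (B s)] were infinite, [s] and [s + 1] would both be maximizers. *)
have wfin s : 0 <= s -> width P xi (B s) \is a fin_num.
  move=> s0; rewrite ge0_fin_numE; last by apply: width_ge0; exact: B0.
  rewrite ltey; apply/eqP => ws.
  have r1 t : s <= t -> t = r 1.
    move=> st; have t0 := le_trans s0 st.
    have wt : width P xi (B t) = +oo%E.
      by apply/eqP; rewrite -leye_eq -ws; apply: width_le; [exact: B0|exact: Bnd].
    have : [set r 1] t by rewrite -r_argmax//; split=> // y _; rewrite -/(B t) wt leey.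
    by [].
  have := r1 (s + 1); rewrite lerDl ler01 -(r1 s)// => /(_ isT); lra.

(* The real-valued envelope [F] and its monotonicity *)
pose g s := fine (width P xi (B s)).
have gE s : 0 <= s -> width P xi (B s) = (g s)%:E by move=> s0; rewrite fineK ?wfin.
pose F sigma := g (r sigma) - r sigma ^+ 2 / (2 * sigma).
have F_max sigma s : 0 < sigma -> 0 <= s -> g s - s ^+ 2 / (2 * sigma) <= F sigma.
  move=> sigma0 s0; have [rs0 /(_ s s0)] := rP _ sigma0.
  by rewrite !gE// -!EFinB lee_fin.
(* Absorbing the factor one half makes the penalty linear in the inverse parameter, as
   [integral_envelope] expects. *)
pose q sigma := 2^-1 * r sigma ^+ 2.
have qE sigma nu : 0 < nu -> r sigma ^+ 2 / (2 * nu) = q sigma * nu^-1.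
  by move=> nu0; rewrite /q invfM; ring.
have q0 x : 0 < x -> 0 <= q x by move=> x0; rewrite mulr_ge0 ?sqr_ge0// invr_ge0.
have HF x y : 0 < x -> x <= y ->
    q x * (x^-1 - y^-1) <= F y - F x <= q y * (x^-1 - y^-1).
  move=> x0 xy; have y0 := lt_le_trans x0 xy.
  have := F_max y _ y0 (r0 _ x0); have := F_max x _ x0 (r0 _ y0).
  rewrite /F !qE// => h1 h2; apply/andP; split; lra.
have qnd x y : 0 < x -> x <= y -> q x <= q y.
  move=> x0; rewrite le_eqVlt => /predU1P[->//|xy].
  have /andP[h1 h2] := HF _ _ x0 (ltW xy).
  have h : 0 < x^-1 - y^-1 by rewrite subr_gt0 ltf_pV2// posrE (lt_trans x0).
  by rewrite -(ler_pM2r h) (le_trans h1).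
have rnd x y : 0 < x -> x <= y -> r x <= r y.
  move=> x0 xy; have y0 := lt_le_trans x0 xy.
  by have := qnd _ _ x0 xy; rewrite /q ler_pM2l ?invr_gt0// ler_sqr ?nnegrE ?r0.
have Fnd x y : 0 < x -> x <= y -> F x <= F y.
  move=> x0 xy; have y0 := lt_le_trans x0 xy.
  have /andP[h _] := HF _ _ x0 xy; rewrite -subr_ge0 (le_trans _ h)//.
  by rewrite mulr_ge0 ?q0// subr_ge0 lef_pV2.
have F_le sigma : 0 < sigma -> F sigma <= g (r sigma).
  by move=> sigma0; rewrite gerBl divr_ge0 ?sqr_ge0// mulr_ge0// ltW.
have F_ge0 sigma : 0 < sigma -> 0 <= F sigma.
  move=> sigma0; apply: le_trans (F_max _ _ sigma0 (lexx 0)).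
  rewrite expr0n/= mul0r subr0; apply: fine_ge0; apply: width_ge0; exact: B0.

(* Limit of the envelope at infinity *)
have Fcvg a : 0 < a -> (F (a + n%:R))%:E @[n --> \oo] --> width P xi T.
  move=> a0; have an n : 0 < a + n%:R by rewrite ltr_wpDr.
  (* [F] is nondecreasing, so the sequence tends to its supremum, which remains to be identified
     with the width of [T]. *)
  rewrite (_ : width P xi T = ereal_sup (range (fun n => (F (a + n%:R))%:E))).
    apply: ereal_nondecreasing_cvgn => m n mn.
    by rewrite lee_fin Fnd// lerD2l ler_nat.
  apply/eqP; rewrite eq_le; apply/andP; split; last first.
    apply: ge_ereal_sup => _ [n _ <-].
    apply: (@le_trans _ _ (g (r (a + n%:R)))%:E); first by rewrite lee_fin F_le.
    by rewrite -gE ?r0// Bw ?r0.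
  rewrite (_ : T = \bigcup_n B n%:R); last first.
    apply/seteqP; split=> [x Tx|x [n _ []]//].
    exists (Num.bound (norm2 x)) => //; split=> //.
    by rewrite scaleset_ball2E//= ltW// archi_boundP// sqrtr_ge0.
  apply: width_bigcup_le => [n|m n mn|m]; [exact: B0|by apply: Bnd; rewrite ?ler_nat|].
  apply/lee_addgt0Pr => e e0.
  (* Chosen so that the penalty of the radius [m] at parameter [a + n] is at most [e]; testing the
     maximum at [m] then bounds the width of [B m] by [F (a + n) + e]. *)
  pose n := Num.bound (m%:R ^+ 2 / (2 * e)).
  have := F_max (a + n%:R) m%:R (an n) (ler0n _ _).
  have hn : m%:R ^+ 2 / (2 * (a + n%:R)) <= e.
    rewrite ler_pdivrMr ?mulr_gt0//.
    have : m%:R ^+ 2 / (2 * e) <= n%:R.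
      by rewrite ltW// archi_boundP// divr_ge0 ?sqr_ge0// mulr_ge0// ltW.
    rewrite ler_pdivrMr ?mulr_gt0//.
    have : 0 < e * a by rewrite mulr_gt0.
    lra.
  move=> hF; apply: (@le_trans _ _ (F (a + n%:R) + e)%:E).
    by rewrite gE// lee_fin; lra.
  by rewrite EFinD leeD2r//; apply: ereal_sup_ubound; exists n.

(* Limit of the envelope at zero *)
have F0 : (F n.+1%:R^-1)%:E @[n --> \oo] --> 0%E.
  have iS n : 0 < n.+1%:R^-1 :> R by rewrite invr_gt0.
  apply: (@squeeze_cvge _ _ _ _ (cst 0%E) _
    (fun n => width P xi (B (r n.+1%:R^-1)))) => //.
  - by apply: nearW => n; rewrite lee_fin F_ge0//= gE ?r0// lee_fin F_le.
  - exact: cvg_cst.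
  (* The parameters [1 / (n + 1)] are at most 1, so by monotonicity of [r] all the sets lie in
     [B (r 1)], whose width is finite. What remains is that the radii tend to 0. *)
  apply: (@width_cvg0 _ _ _ _ _ _ _ (B (r 1)) (fun n => r n.+1%:R^-1)).
  - by move=> n; apply: B0; rewrite r0.
  - by move=> n; apply: Bnd; rewrite ?r0// rnd// invf_le1// ler1n.
  - by rewrite gE ?r0// ltry.
  - move=> n x i [_]; rewrite scaleset_ball2E ?r0//=.
    exact: le_trans (coord_le_norm2 x i).
  have sq0 : (fun n => r n.+1%:R^-1 ^+ 2) @ \oo --> 0.
    (* With [x = 1 / (n + 1)], [HF] between [x] and 1 gives [q x * n <= F 1 - F x <= F 1]. Adding
       [q x <= q 1] yields [q x * (n + 1) <= F 1 + q 1], and [r x ^+ 2] is twice [q x]. *)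
    apply: (@squeeze_cvgr _ _ _ _ (cst 0) (fun n => 2 * (F 1 + q 1) * n.+1%:R^-1)).
    - apply: nearW => n; rewrite sqr_ge0/= ler_pdivlMr//.
      have i1 : n.+1%:R^-1 <= 1 :> R by rewrite invf_le1// ler1n.
      have /andP[+ _] := HF _ _ (iS n) i1; rewrite invrK invr1.
      have := qnd _ _ (iS n) i1; have := F_ge0 _ (iS n); rewrite /q; lra.
    - exact: cvg_cst.
    - rewrite -[X in _ --> X](mulr0 (2 * (F 1 + q 1))).
      by apply: cvgMl_tmp; exact: cvg_harmonic.
  rewrite (_ : (fun n => r n.+1%:R^-1) = Num.sqrt \o (fun n => r n.+1%:R^-1 ^+ 2)).
    by rewrite -[X in _ --> X]sqrtr0; exact: cvg_comp sq0 (@sqrt_continuous R 0).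
  by apply/funext => n /=; rewrite sqrtr_sqr ger0_norm ?r0.

(* Both identities; [x = 0] is allowed here so that [qint] serves the two integrals *)
have qint x : 0 <= x -> ((2^-1)%:E * \int[lebesgue_measure]_(nu in `]x, +oo[)
    (r nu ^+ 2 / nu ^+ 2)%:E =
    \int[lebesgue_measure]_(nu in `]x, +oo[) (q nu / nu ^+ 2)%:E)%E.
  move=> x0; rewrite -ge0_integralZl ?lee_fin ?invr_ge0//.
  - by apply: eq_integral => nu _; rewrite -EFinM /q mulrA.
  - apply: measurable_funS (@measurable_fun_div_sqr _ (fun nu => r nu ^+ 2) _ _) => //.
    + by move=> nu /=; rewrite !in_itv/= !andbT; exact: le_lt_trans.
    + by move=> nu _; exact: sqr_ge0.
    + by move=> y z y0 yz; rewrite ler_sqr ?nnegrE ?r0 ?rnd// (lt_le_trans y0).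
  - by move=> nu _; rewrite lee_fin divr_ge0 ?sqr_ge0.
have wE sigma : 0 < sigma -> (width P xi T =
    (F sigma)%:E + \int[lebesgue_measure]_(nu in `]sigma, +oo[) (q nu / nu ^+ 2)%:E)%E.
  by move=> sigma0; apply: integral_envelope_tail => //; exact: Fcvg.
split=> [sigma sigma0|]; rewrite qint ?(ltW sigma0)//.
  by rewrite -/(B _) gE ?r0// -EFinB; exact: wE.
exact: (integral_envelope_setT q0 qnd wE F0).
Qed.
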